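(* Let $H$ be a finitely generated and amenable group and let $\Gamma=H\wr\mathbb{Z}$. The equivariant Hilbert space compression satisfies $$R_H(H)\ \geqslant\ R_\Gamma(\Gamma)\ \geqslant\ \frac{R_H(H)}{R_H(H)+1}\,.$$
   Context: Wreath product: $H\wr\mathbb{Z}=\left(\bigoplus_{\mathbb{Z}}H\right)\rtimes\mathbb{Z}$, where $\bigoplus_{\mathbb{Z}}H$ is the group of finitely supported functions $\lambda:\mathbb{Z}\to H$ and $\mathbb{Z}$ acts by $(n\cdot\lambda)(x)=\lambda(x-n)$. For a finitely generated group $G$, endowed with the word metric $d(x,y)=|x^{-1}y|$ associated with a finite generating set and with the action of $G$ by left multiplication, the equivariant Hilbert space compression $R_G(G)$ is the supremum of the numbers $\alpha\in[0,1]$ such that there exist a Hilbert space $\mathcal{H}$ endowed with an action of $G$ by affine isometries, positive constants $C_1,C_2$ and a $G$-equivariant map $f:G\to\mathcal{H}$ with $$C_1\, d(x,y)^\alpha\leqslant\|f(x)-f(y)\|\leqslant C_2\, d(x,y)\quad\text{for all }x,y\in G.$$ It does not depend on the choice of the finite generating set. *)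

(* Defs.v *)
From HB Require Import structures.
From mathcomp Require Import all_boot all_order all_algebra finmap.
From mathcomp Require Import sesquilinear.
From mathcomp Require Import boolp classical_sets reals topology normedtype exp.

Set Implicit Arguments.
Unset Strict Implicit.
Unset Printing Implicit Defensive.

Import Order.TTheory GRing.Theory Num.Theory.
Import numFieldNormedType.Exports.

Local Open Scope ring_scope.
Local Open Scope classical_set_scope.

Section Words.
Variable G : groupType.
Implicit Types (S w : seq G) (g x y : G).

Definition is_word S w : bool :=
  all (fun x => (x \in S) || ((x^-1)%g \in S)) w.

Definition spells S g w : Prop := is_word S w /\ (\prod_(x <- w) x)%g = g.

Definition generates S : Prop := forall g, exists w, spells S g w.

Lemma spells1 S : spells S 1%g [::].
Proof. by split=> //; rewrite big_nil. Qed.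

Lemma spells_mem S x : x \in S -> spells S x [:: x].
Proof. by move=> xS; split; rewrite ?big_seq1 //= xS. Qed.

Lemma spellsM S g1 g2 w1 w2 :
  spells S g1 w1 -> spells S g2 w2 -> spells S (g1 * g2)%g (w1 ++ w2).
Proof.
move=> [w1S <-] [w2S <-]; split; first by rewrite /is_word all_cat; apply/andP.
by rewrite big_cat.
Qed.

Lemma spellsV S g w :
  spells S g w -> spells S (g^-1)%g (rev [seq (x^-1)%g | x <- w]).
Proof.
move=> [wS <-]; split.
  rewrite /is_word all_rev all_map; apply: sub_all wS => x /=.
  by rewrite invgK orbC.
elim: w {wS} => [|x w IHw]; first by rewrite !big_nil invg1.
by rewrite /= rev_cons -cats1 big_cat big_seq1 big_cons /= IHw invgM.
Qed.

Section WordMetric.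
Variables (S : seq G) (hS : generates S).

Fact word_length_ex g :
  exists n, `[< exists2 w, spells S g w & size w = n >].
Proof. by have [w ?] := hS g; exists (size w); apply/asboolP; exists w. Qed.

Definition word_length g : nat := ex_minn (word_length_ex g).

Definition word_dist x y : nat := word_length (x^-1 * y)%g.

End WordMetric.
End Words.

(* Existence of a left-invariant mean on the space of bounded real functions;
   the values of [m] on unbounded functions are irrelevant. *)
Definition amenable (R : realType) (G : groupType) : Prop :=
  exists m : (G -> R) -> R,
  [/\ forall (a : R) (u v : G -> R), bounded_fun u -> bounded_fun v ->
        m (fun x => a * u x + v x) = a * m u + m v,
      forall u : G -> R, bounded_fun u -> (forall x, 0 <= u x) -> 0 <= m u,
      m (fun=> 1) = 1 &
      forall (g : G) (u : G -> R), bounded_fun u ->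
        m (fun x => u (g^-1 * x)%g) = m u].

Section Compression.
Variable R : realType.

(* With [V] complete, this says that [V] is a real Hilbert space. *)
Definition norm_of_dot (V : normedModType R) (dot : {dot V for idfun}) : Prop :=
  forall v : V, `|v| ^+ 2 = dot v v.

Definition affine_map (V : lmodType R) (T : V -> V) : Prop :=
  exists (L : {linear V -> V}) (b : V), forall v, T v = L v + b.

Definition affine_isometric_action (G : groupType) (V : normedModType R)
    (A : G -> V -> V) : Prop :=
  [/\ forall v, A 1%g v = v,
      forall g h v, A (g * h)%g v = A g (A h v),
      forall g, affine_map (A g) &
      forall g v w, `|A g v - A g w| = `|v - w|].

Variables (G : groupType) (S : seq G) (hS : generates S).

(* For [x = y] and [0 < a] both bounds read [0 <= 0].  The lower bound is
   restricted to [x != y] because [0 `^ 0 = 1]: the exponent [a = 0] would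
   otherwise be excluded on the diagonal. *)
Definition compression_bounds (V : normedModType R) (f : G -> V) (a : R) : Prop :=
  exists C1 C2 : R, [/\ 0 < C1, 0 < C2 &
    forall x y : G,
      (x != y -> C1 * (word_dist hS x y)%:R `^ a <= `|f x - f y|) /\
      `|f x - f y| <= C2 * (word_dist hS x y)%:R].

Definition equivariant_exponents : set R :=
  [set a | 0 <= a <= 1 /\
    exists (V : completeNormedModType R) (dot : {dot V for idfun})
           (A : G -> V -> V) (f : G -> V),
    [/\ norm_of_dot dot,
        affine_isometric_action A,
        forall g x, f (g * x)%g = A g (f x) &
        compression_bounds f a]].

Definition equivariant_compression : R := sup equivariant_exponents.

End Compression.

Definition lamps (H : groupType) : Type := {fsfun int -> H with 1%g}.

Section Lamps.
Variable H : groupType.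

HB.instance Definition _ := Choice.on (lamps H).

Implicit Types (l k : lamps H) (x n : int).

Definition lamp_at l x : H := (l : {fsfun int -> H with 1%g}) x.

Lemma lampsP l k : lamp_at l =1 lamp_at k -> l = k.
Proof. by move=> /fsfunP. Qed.

Definition lamps_one : lamps H := [fsfun with 1%g].

Definition lamps_mul l k : lamps H :=
  [fsfun x in (finsupp l `|` finsupp k)%fset => (lamp_at l x * lamp_at k x)%g].

Definition lamps_inv l : lamps H :=
  [fsfun x in finsupp l => ((lamp_at l x)^-1)%g].

Definition lamps_shift n l : lamps H :=
  [fsfun x in [fset (y + n)%R | y in finsupp l]%fset => lamp_at l (x - n)].

Definition lamps_single x (h : H) : lamps H := [fsfun y in [fset x]%fset => h].

Lemma lamps_oneE x : lamp_at lamps_one x = 1%g.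
Proof. by rewrite /lamp_at /lamps_one fsfunE. Qed.

Lemma lamps_mulE l k x :
  lamp_at (lamps_mul l k) x = (lamp_at l x * lamp_at k x)%g.
Proof.
rewrite {1}/lamp_at /lamps_mul fsfunE in_fsetU /lamp_at.
by case: finsuppP => // _; case: finsuppP => //= _; rewrite mulg1.
Qed.

Lemma lamps_invE l x : lamp_at (lamps_inv l) x = ((lamp_at l x)^-1)%g.
Proof.
rewrite {1}/lamp_at /lamps_inv fsfunE /lamp_at.
by case: finsuppP => // _; rewrite invg1.
Qed.

Lemma lamps_shiftE n l x : lamp_at (lamps_shift n l) x = lamp_at l (x - n).
Proof.
rewrite {1}/lamp_at /lamps_shift fsfunE; case: ifPn => // /imfsetP xNl.
rewrite /lamp_at; case: finsuppP => // xl; case: xNl.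
by exists (x - n); rewrite ?subrK.
Qed.

Lemma lamps_singleE x h y :
  lamp_at (lamps_single x h) y = if y == x then h else 1%g.
Proof. by rewrite /lamp_at /lamps_single fsfunE inE. Qed.

Fact lamps_mulA : associative lamps_mul.
Proof. by move=> a b c; apply: lampsP => x; rewrite !lamps_mulE mulgA. Qed.
Fact lamps_mul1 : left_id lamps_one lamps_mul.
Proof. by move=> a; apply: lampsP => x; rewrite lamps_mulE lamps_oneE mul1g. Qed.
Fact lamps_1mul : right_id lamps_one lamps_mul.
Proof. by move=> a; apply: lampsP => x; rewrite lamps_mulE lamps_oneE mulg1. Qed.
Fact lamps_mulV : left_inverse lamps_one lamps_inv lamps_mul.
Proof.
by move=> a; apply: lampsP => x; rewrite lamps_mulE lamps_invE lamps_oneE mulVg.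
Qed.
Fact lamps_Vmul : right_inverse lamps_one lamps_inv lamps_mul.
Proof.
by move=> a; apply: lampsP => x; rewrite lamps_mulE lamps_invE lamps_oneE mulgV.
Qed.

HB.instance Definition _ := isGroup.Build (lamps H)
  lamps_mulA lamps_mul1 lamps_1mul lamps_mulV lamps_Vmul.

Lemma lampsE :
  ((forall x, lamp_at 1%g x = 1%g)
   * (forall l k x, lamp_at (l * k)%g x = (lamp_at l x * lamp_at k x)%g)
   * (forall l x, lamp_at (l^-1)%g x = ((lamp_at l x)^-1)%g)
   * (forall n l x, lamp_at (lamps_shift n l) x = lamp_at l (x - n)))%type.
Proof.
split; [split; [split|] |].
- exact: lamps_oneE.
- exact: lamps_mulE.
- exact: lamps_invE.
- exact: lamps_shiftE.
Qed.

End Lamps.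

Record wreathZ (H : groupType) : Type :=
  Wreath { lamp : lamps H; cursor : int }.

Section WreathZ.
Variable H : groupType.
Implicit Types p q : wreathZ H.

Definition wreath_pair p := (lamp p, cursor p).
Definition pair_wreath (u : lamps H * int) := Wreath u.1 u.2.
Fact wreath_pairK : cancel wreath_pair pair_wreath. Proof. by case. Qed.

HB.instance Definition _ := Choice.copy (wreathZ H) (can_type wreath_pairK).

Definition wreath_one : wreathZ H := Wreath 1%g 0.
Definition wreath_mul p q : wreathZ H :=
  Wreath (lamp p * lamps_shift (cursor p) (lamp q))%g (cursor p + cursor q).
Definition wreath_inv p : wreathZ H :=
  Wreath (lamps_shift (- cursor p) (lamp p)^-1)%g (- cursor p).

Lemma wreathP p q :
  lamp_at (lamp p) =1 lamp_at (lamp q) -> cursor p = cursor q -> p = q.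
Proof. by case: p q => [l n] [k m] /= /lampsP -> ->. Qed.

Fact wreath_mulA : associative wreath_mul.
Proof.
move=> p q r; apply: wreathP => [x|] /=; last by rewrite addrA.
by rewrite !lampsE mulgA opprD addrA.
Qed.
Fact wreath_mul1 : left_id wreath_one wreath_mul.
Proof.
move=> p; apply: wreathP => [x|] /=; last by rewrite add0r.
by rewrite !lampsE mul1g subr0.
Qed.
Fact wreath_1mul : right_id wreath_one wreath_mul.
Proof.
by move=> p; apply: wreathP => [x|] /=; rewrite ?addr0 // !lampsE mulg1.
Qed.
Fact wreath_mulV : left_inverse wreath_one wreath_inv wreath_mul.
Proof.
by move=> p; apply: wreathP => [x|] /=; rewrite ?addNr // !lampsE mulVg.
Qed.
Fact wreath_Vmul : right_inverse wreath_one wreath_inv wreath_mul.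
Proof.
move=> p; apply: wreathP => [x|] /=; rewrite ?addrN // !lampsE.
by rewrite opprK subrK mulgV.
Qed.

HB.instance Definition _ := isGroup.Build (wreathZ H)
  wreath_mulA wreath_mul1 wreath_1mul wreath_mulV wreath_Vmul.

Definition wreath_base (h : H) : wreathZ H := Wreath (lamps_single 0 h) 0.
Definition wreath_gen : wreathZ H := Wreath 1%g 1.

Lemma wreath_mulE p q : (p * q)%g =
  Wreath (lamp p * lamps_shift (cursor p) (lamp q))%g (cursor p + cursor q).
Proof. by []. Qed.

Lemma wreathZ_generates (S : seq H) :
  generates S -> generates (wreath_gen :: map wreath_base S).
Proof.
move=> hS; set T := _ :: _.
pose gen g := exists w, spells T g w.
have gen1 : gen 1%g by exists [::]; exact: spells1.
have genM g1 g2 : gen g1 -> gen g2 -> gen (g1 * g2)%g.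
  by move=> [w1 h1] [w2 h2]; exists (w1 ++ w2); exact: spellsM.
have genV g : gen g -> gen (g^-1)%g.
  by move=> [w h]; exists (rev [seq (x^-1)%g | x <- w]); exact: spellsV.
have gen_mem g : g \in T -> gen g by exists [:: g]; exact: spells_mem.
have gen_base h : gen (wreath_base h).
  have base1 : wreath_base 1%g = 1%g.
    apply: wreathP => //= x; rewrite lamps_singleE lampsE.
    by case: ifP.
  have baseM a b : wreath_base (a * b)%g = (wreath_base a * wreath_base b)%g.
    apply: wreathP => //= x; rewrite !lampsE !lamps_singleE subr0.
    by case: ifP => // _; rewrite mulg1.
  have baseV a : wreath_base (a^-1)%g = ((wreath_base a)^-1)%g.
    apply: (@mulgI _ (wreath_base a)); rewrite -baseM !mulgV.
    exact: base1.
  have [w [wS <-]] := hS h.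
  elim: w wS => [_|x w IHw /= /andP[xS wS]]; first by rewrite big_nil base1.
  rewrite big_cons baseM; apply: genM; last exact: IHw.
  case/orP: xS => xS; first by apply: gen_mem; rewrite inE map_f ?orbT.
  by rewrite -[x]invgK baseV; apply/genV/gen_mem; rewrite inE map_f ?orbT.
have gen_cursor n : gen (Wreath 1%g n).
  have gen_nat (k : nat) : gen (Wreath 1%g k%:Z).
    elim: k => [|k IHk]; first exact: gen1.
    suff -> : Wreath 1%g k.+1%:Z = (wreath_gen * Wreath 1%g k%:Z)%g.
      by apply: genM => //; apply: gen_mem; rewrite inE eqxx.
    by apply: wreathP => [x|] /=; rewrite ?lampsE ?mulg1 // intS.
  case: (intP n) => [|k|k]; [exact: gen_nat 0|exact: gen_nat|].
  suff -> : Wreath 1%g (- k.+1%:Z) = ((Wreath 1%g k.+1%:Z : wreathZ H)^-1)%g.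
    exact/genV/gen_nat.
  by apply: wreathP => [x|] //=; rewrite !lampsE invg1.
have gen_single x h : gen (Wreath (lamps_single x h) 0).
  suff -> : Wreath (lamps_single x h) 0 =
    (Wreath 1%g x * wreath_base h * (Wreath 1%g x : wreathZ H)^-1)%g.
    exact: (genM _ _ (genM _ _ (gen_cursor x) (gen_base h))
                 (genV _ (gen_cursor x))).
  apply: wreathP => [y|] /=; last by rewrite addr0 subrr.
  rewrite !lampsE !lamps_singleE subr_eq0 invg1 mulg1.
  by rewrite mul1g.
have gen_lamps (s : seq int) (l : lamps H) :
    (forall x, x \notin s -> lamp_at l x = 1%g) -> gen (Wreath l 0).
  elim: s l => [|x s IHs] l ls.
    suff -> : l = 1%g by exact: gen1.
    by apply: lampsP => x; rewrite lampsE ls.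
  suff -> : Wreath l 0 = (Wreath (lamps_single x (lamp_at l x)) 0
      * Wreath ((lamps_single x (lamp_at l x))^-1 * l) 0)%g.
    apply: genM => //; apply: IHs => y ys; rewrite !lampsE lamps_singleE.
    have [->|yx] := eqVneq y x; first by rewrite mulVg.
    by rewrite invg1 mul1g ls // inE negb_or yx.
  apply: wreathP => [y|] //=; by rewrite !lampsE subr0 mulVKg.
move=> [l n]; suff -> : Wreath l n = (Wreath l 0 * Wreath 1%g n)%g.
  apply: genM => //; apply: (gen_lamps (finsupp l)) => x.
  exact: fsfun_dflt.
by apply: wreathP => [x|] /=; rewrite ?add0r // !lampsE mulg1.
Qed.

End WreathZ.

(* Main.v *)
Require Import Defs.
From HB Require Import structures.
From mathcomp Require Import all_boot all_order all_algebra finmap.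
From mathcomp Require Import boolp classical_sets functions fsbigop.
From mathcomp Require Import reals ereal normedtype exp esum.
From mathcomp Require Import ring lra zify.

Set Implicit Arguments.
Unset Strict Implicit.
Unset Printing Implicit Defensive.

Import Order.TTheory GRing.Theory Num.Theory.
Import numFieldNormedType.Exports.

Local Open Scope ring_scope.
Local Open Scope classical_set_scope.

(** * Idea of the proof

The first inequality holds because the lamp group is undistorted in the wreath
product: an affine isometric action of the wreath product and an equivariant map
restrict to the lamp group with the same exponent
([equivariant_exponents_wreath]).

For the second one, let [f] embed the lamp group equivariantly in a Hilbert
space [V] with a positive exponent [a]. The length of an element of the wreath
product is at most a multiple of [r] plus the sum of the lengths of its lamps,
where [r] is the length of the shortest interval containing [0], the cursor and
the lamps that are on ([wreath_length_le]). Both parts are seen by a Hilbert sum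
of copies of [V]:
- in the copy indexed by a position [x], put the image by [f] of the lamp at
  [x]; these coordinates contribute to the squared norm at least a positive
  multiple of the sum of the [|h| ^ (2 a)] over the lamps [h];
- in the copy indexed by a half-space, put a fixed unit vector or [0] according
  to whether the element lies in the half-space. A half-space consists of the
  elements whose cursor lies on one side of a position and whose lamps on the
  other side are prescribed. Finitely many half-spaces separate [1] from a given
  element, and at least [r] do ([embedding_norm_ge]).

Subtracting the value at [1] makes the coordinates square-summable. The wreath
product permutes the half-spaces, and moves the lamp coordinates by translation
and by the action of the lamps, so this map is equivariant for an affine
isometric action ([embedding_action_isometric]); equivariant maps on a finitely
generated group are Lipschitz ([equivariant_lipschitz]). If [b] is the minimum
of [a] and [1/2], then the power [2 b] is subadditive, so that the power [2 b]
of the length is bounded by a multiple of the squared norm. Hence [b] is an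
exponent of the wreath product ([wreath_exponent]). If [c] is the compression of
the lamp group, then the minimum of [c] and [1/2] is at least [c / (c + 1)],
because [c] is at most [1]. *)

(** * Nonnegative sums *)

Section NonnegativeSums.
Variables (R : realType) (I : choiceType).
Implicit Types (a b : I -> R) (s : seq I).

Definition nsummable a := (\esum_(i in [set: I]) (a i)%:E < +oo)%E.

Definition nsum a : R := fine (\esum_(i in [set: I]) (a i)%:E).

Lemma nsum_ge0 a : (forall i, 0 <= a i) -> 0 <= nsum a.
Proof. by move=> a0; apply/fine_ge0/esum_ge0 => i _; rewrite lee_fin. Qed.

Lemma nsumE a : (forall i, 0 <= a i) -> nsummable a ->
  (nsum a)%:E = \esum_(i in [set: I]) (a i)%:E.
Proof.
move=> a0 sa; rewrite fineK // ge0_fin_numE //.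
by apply: esum_ge0 => i _; rewrite lee_fin.
Qed.

Lemma nsum_ge_seq a s : (forall i, 0 <= a i) -> nsummable a -> uniq s ->
  \sum_(i <- s) a i <= nsum a.
Proof.
move=> a0 sa us; rewrite -lee_fin nsumE // -sumEFin.
apply: esum_ge; exists [set` s]; first by split.
by rewrite fsbig_seq.
Qed.

Lemma nsum_le_seq a (M : R) : (forall i, 0 <= a i) ->
    (forall s, uniq s -> \sum_(i <- s) a i <= M) ->
  nsummable a /\ nsum a <= M.
Proof.
move=> a0 aM; have le_esumM : (\esum_(i in [set: I]) (a i)%:E <= M%:E)%E.
  apply: ge_ereal_sup => _ [X [finX _] <-].
  by rewrite fsbig_finite //= sumEFin lee_fin aM.
have sa : nsummable a by apply: (le_lt_trans le_esumM); exact: ltry.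
by split=> //; rewrite -lee_fin nsumE.
Qed.

Lemma le_nsum a b : (forall i, 0 <= a i <= b i) -> nsummable b ->
  nsummable a /\ nsum a <= nsum b.
Proof.
move=> ab sb; apply: nsum_le_seq => [i|s us]; first by case/andP: (ab i).
apply: (le_trans _ (nsum_ge_seq _ sb us)).
  by apply: ler_sum => i _; case/andP: (ab i).
by move=> i; case/andP: (ab i) => /le_trans; apply.
Qed.

Lemma nsumD a b : (forall i, 0 <= a i) -> (forall i, 0 <= b i) ->
    nsummable a -> nsummable b ->
  nsummable (fun i => a i + b i) /\ nsum (fun i => a i + b i) = nsum a + nsum b.
Proof.
move=> a0 b0 sa sb.
have eD : (\esum_(i in [set: I]) (a i + b i)%:E = (nsum a + nsum b)%:E)%E.
  rewrite EFinD !nsumE // -esumD => [|i _|i _]; rewrite ?lee_fin //.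
by split; rewrite /nsummable /nsum eD // ltry.
Qed.

Lemma nsumZ (c : R) a : 0 <= c -> (forall i, 0 <= a i) -> nsummable a ->
  nsummable (fun i => c * a i) /\ nsum (fun i => c * a i) = c * nsum a.
Proof.
have leZ (d : R) (b : I -> R) : 0 <= d -> (forall i, 0 <= b i) ->
    nsummable b ->
    nsummable (fun i => d * b i) /\ nsum (fun i => d * b i) <= d * nsum b.
  move=> d0 b0 sb; apply: nsum_le_seq => [i|s us]; first exact: mulr_ge0.
  by rewrite -mulr_sumr ler_wpM2l // nsum_ge_seq.
move=> c0 a0 sa; have [sca leca] := leZ c a c0 a0 sa; split=> //.
apply: le_anti; rewrite leca /=.
have [->|cN0] := eqVneq c 0.
  by rewrite mul0r nsum_ge0 // => i; rewrite mul0r.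
have ca0 i : 0 <= c * a i by exact: mulr_ge0.
have c'0 : 0 <= c^-1 by rewrite invr_ge0.
have [_] := leZ c^-1 _ c'0 ca0 sca.
rewrite (_ : (fun i => _) = a); last by apply/funext => i; rewrite mulKf.
by rewrite ler_pdivlMl // lt_neqAle eq_sym cN0.
Qed.

Lemma nsummable_finite a (s : seq I) : (forall i, 0 <= a i) ->
  (forall i, i \notin s -> a i = 0) -> nsummable a.
Proof.
move=> a0 as0; have [] // := @nsum_le_seq a (\sum_(i <- undup s) a i) a0.
move=> t ut; rewrite (bigID (mem s)) /= [X in _ + X]big1 => [|i /as0 //].
have pst : perm_eq [seq i <- t | i \in s] [seq i <- undup s | i \in t].
  apply: uniq_perm; rewrite ?filter_uniq ?undup_uniq // => i.
  by rewrite !mem_filter mem_undup andbC.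
rewrite addr0 -big_filter (perm_big _ pst) big_filter.
by rewrite [leRHS](bigID (mem t)) /= lerDl sumr_ge0.
Qed.

Lemma nsum_reindex a (e : I -> I) : bijective e -> nsum (a \o e) = nsum a.
Proof.
move=> [e' ee' e'e]; rewrite /nsum [in RHS](reindex_esum setT setT e) //.
split=> //; first by move=> x y _ _ /(can_inj ee').
by move=> y _; exists (e' y).
Qed.

Lemma nsummable_reindex a (e : I -> I) :
  bijective e -> nsummable a -> nsummable (a \o e).
Proof.
move=> [e' ee' e'e]; rewrite /nsummable (reindex_esum setT setT e) //.
split=> //; first by move=> x y _ _ /(can_inj ee').
by move=> y _; exists (e' y).
Qed.

End NonnegativeSums.

(** * Hilbert sums *)

Section SquareSummable.
Variables (R : realType) (I : choiceType) (V : normedModType R).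
Implicit Types (f g : I -> V).

Definition sqnorms f : I -> R := fun i => `|f i| ^+ 2.

Lemma sqnorms_ge0 f i : 0 <= sqnorms f i.
Proof. exact: exprn_ge0. Qed.

Definition sqsummable : {pred (I -> V)} :=
  fun f => `[< nsummable (sqnorms f) >].

Lemma sqsummableP f : reflect (nsummable (sqnorms f)) (f \in sqsummable).
Proof. exact: asboolP. Qed.

Lemma sqnormsZ (c : R) f : sqnorms (c *: f) = (fun i => c ^+ 2 * sqnorms f i).
Proof.
by apply/funext => i; rewrite /sqnorms normrZ exprMn real_normK ?num_real.
Qed.

(** This weighted form of the triangle inequality is linear in the squares, so
it can be summed; optimising the weight afterwards gives Minkowski's
inequality without passing through finite sums. *)
Lemma sqnormsD (c : R) f g i : 0 < c ->
  sqnorms (f + g) i <= (1 + c) * sqnorms f i + (1 + c^-1) * sqnorms g i.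
Proof.
move=> c0; rewrite /sqnorms; set x := `|f i|; set y := `|g i|.
have [x0 y0] : 0 <= x /\ 0 <= y by split; exact: normr_ge0.
apply: (@le_trans _ _ ((x + y) ^+ 2)).
  by rewrite ler_pXn2r ?nnegrE ?addr_ge0 //; exact: ler_normD.
rewrite -subr_ge0.
have -> : (1 + c) * x ^+ 2 + (1 + c^-1) * y ^+ 2 - (x + y) ^+ 2
        = c^-1 * (c * x - y) ^+ 2 by field; rewrite gt_eqF.
by rewrite mulr_ge0 ?sqr_ge0 // invr_ge0 ltW.
Qed.

Lemma nsum_sqnormsD (c : R) f g : 0 < c ->
    nsummable (sqnorms f) -> nsummable (sqnorms g) ->
  nsummable (sqnorms (f + g)) /\
  nsum (sqnorms (f + g)) <=
    (1 + c) * nsum (sqnorms f) + (1 + c^-1) * nsum (sqnorms g).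
Proof.
move=> c0 sf sg; have d0 : 0 < c^-1 by rewrite invr_gt0.
have [sf' <-] := nsumZ (addr_ge0 ler01 (ltW c0)) (@sqnorms_ge0 f) sf.
have [sg' <-] := nsumZ (addr_ge0 ler01 (ltW d0)) (@sqnorms_ge0 g) sg.
have nneg (d : R) h i : 0 < d -> 0 <= (1 + d) * sqnorms h i.
  by move=> ?; rewrite mulr_ge0 ?sqnorms_ge0 // addr_ge0 // ltW.
have [sfg <-] :=
  nsumD (fun i => nneg _ f i c0) (fun i => nneg _ g i d0) sf' sg'.
by apply: le_nsum sfg => i; rewrite sqnorms_ge0 sqnormsD.
Qed.

Lemma sqsummable_submod : submod_closed sqsummable.
Proof.
split=> [|c f g /sqsummableP sf /sqsummableP sg]; apply/sqsummableP.
  apply: (@nsummable_finite _ _ _ [::]) => [i|i _]; first exact: sqnorms_ge0.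
  by rewrite /sqnorms normr0 expr0n.
apply: (nsum_sqnormsD ltr01 _ sg).1; rewrite sqnormsZ.
by apply: (nsumZ (sqr_ge0 c) _ sf).1 => i; exact: sqnorms_ge0.
Qed.

HB.instance Definition _ :=
  GRing.isSubmodClosed.Build R (I -> V) sqsummable sqsummable_submod.

End SquareSummable.

Record l2 (R : realType) (I : choiceType) (V : normedModType R) :=
  L2 { l2val :> I -> V; l2valP : l2val \in @sqsummable R I V }.

Section HilbertSum.
Variables (R : realType) (I : choiceType) (V : normedModType R).
Implicit Types (x y : l2 I V).

HB.instance Definition _ := [isSub of l2 I V for @l2val R I V].
HB.instance Definition _ := [Choice of l2 I V by <:].
HB.instance Definition _ := [SubChoice_isSubLmodule of l2 I V by <:].

Lemma l2P x y : (forall i, x i = y i) -> x = y.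
Proof. by move=> /funext xy; apply: val_inj. Qed.

Lemma l2DE x y i : (x + y) i = x i + y i. Proof. by []. Qed.

Lemma l2_summable x : nsummable (sqnorms x).
Proof. exact/sqsummableP/l2valP. Qed.

Definition l2norm x : R := Num.sqrt (nsum (sqnorms x)).

Lemma l2norm_ge0 x : 0 <= l2norm x. Proof. exact: sqrtr_ge0. Qed.

Lemma l2norm_sqr x : l2norm x ^+ 2 = nsum (sqnorms x).
Proof. by rewrite sqr_sqrtr // nsum_ge0 // => i; exact: sqnorms_ge0. Qed.

Lemma l2norm_ge_seq x s : uniq s -> \sum_(i <- s) `|x i| ^+ 2 <= l2norm x ^+ 2.
Proof.
move=> us; rewrite l2norm_sqr.
exact: (nsum_ge_seq (@sqnorms_ge0 _ _ _ x) (l2_summable x) us).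
Qed.

Lemma l2norm_ge x i : `|x i| <= l2norm x.
Proof.
rewrite -(@ler_pXn2r _ 2) ?nnegrE ?l2norm_ge0 //.
by have := @l2norm_ge_seq x [:: i] isT; rewrite big_seq1.
Qed.

Lemma l2norm0_eq0 x : l2norm x = 0 -> x = 0.
Proof.
move=> x0; apply: l2P => i; apply/eqP; rewrite -normr_le0 -x0; exact: l2norm_ge.
Qed.

Lemma l2normZ (c : R) x : l2norm (c *: x) = `|c| * l2norm x.
Proof.
rewrite /l2norm sqnormsZ (nsumZ (sqr_ge0 c) _ (l2_summable x)).2.
  by rewrite sqrtrM ?sqr_ge0 // sqrtr_sqr.
by move=> i; exact: sqnorms_ge0.
Qed.

Lemma l2normD x y : l2norm (x + y) <= l2norm x + l2norm y.
Proof.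
have [/l2norm0_eq0 ->|x0] := eqVneq (l2norm x) 0.
  by rewrite add0r lerDr l2norm_ge0.
have [/l2norm0_eq0 ->|y0] := eqVneq (l2norm y) 0.
  by rewrite addr0 lerDl l2norm_ge0.
have {}x0 : 0 < l2norm x by rewrite lt_neqAle eq_sym x0 l2norm_ge0.
have {}y0 : 0 < l2norm y by rewrite lt_neqAle eq_sym y0 l2norm_ge0.
rewrite -(@ler_pXn2r _ 2) ?nnegrE ?addr_ge0 ?l2norm_ge0 // l2norm_sqr.
have c0 : 0 < l2norm y / l2norm x by rewrite divr_gt0.
have [_ /le_trans ->//] := nsum_sqnormsD c0 (l2_summable x) (l2_summable y).
rewrite -!l2norm_sqr le_eqVlt; apply/orP; left; apply/eqP.
by field; rewrite !gt_eqF.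
Qed.

HB.instance Definition _ :=
  Lmodule_isNormed.Build R (l2 I V) l2normD l2normZ l2norm0_eq0.

Lemma l2_normE x : `|x| = l2norm x. Proof. by []. Qed.

Lemma l2_sqnormE x : `|x| ^+ 2 = nsum (sqnorms x).
Proof. by rewrite l2_normE l2norm_sqr. Qed.

End HilbertSum.

Section Completeness.
Variables (R : realType) (I : choiceType) (V : completeNormedModType R).

(** A Cauchy filter on the Hilbert sum converges in every coordinate, and the
bounds on finite partial sums pass to the coordinatewise limit. *)
Lemma l2_complete (F : set_system (l2 I V)) :
  ProperFilter F -> cauchy F -> cvg F.
Proof.
move=> FF /cauchyP Fcauchy.
have cvF i : cvg ((fun x : l2 I V => x i) @ F).
  apply: cauchy_cvg; apply: cauchy_exP => e /Fcauchy[x0 Fx0].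
  exists (x0 i); rewrite /nbhs /=; apply: filterS Fx0 => x /=.
  rewrite -!ball_normE /= => /(le_lt_trans _); apply.
  exact: (l2norm_ge (x0 - x)).
pose y i := lim ((fun x : l2 I V => x i) @ F).
have yF (e : R) (x0 : l2 I V) : F (ball x0 e) ->
    forall s : seq I, uniq s -> \sum_(i <- s) `|y i - x0 i| ^+ 2 <= e ^+ 2.
  move=> Fx0 s us.
  have cvs : (fun x : l2 I V => \sum_(i <- s) `|x i - x0 i| ^+ 2) @ F -->
      (\sum_(i <- s) `|y i - x0 i| ^+ 2).
    apply: cvg_big => [|i _]; first exact: add_continuous.
    have cvi : (fun x : l2 I V => `|x i - x0 i|) @ F --> `|y i - x0 i|.
      by apply: cvg_norm; apply: cvgB; [exact: cvF|exact: cvg_cst].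
    exact: cvgM.
  apply: (cvgr_to_le cvs); apply: filterS Fx0 => x.
  rewrite -ball_normE /= distrC => xx0.
  apply: (le_trans (@l2norm_ge_seq _ _ _ (x - x0) _ us)).
  have e0 : 0 <= e by exact: le_trans (normr_ge0 _) (ltW xx0).
  by rewrite -l2_normE ler_pXn2r ?nnegrE // ltW.
have yl2 : y \in @sqsummable R I V.
  have [x0 Fx0] := Fcauchy 1 ltr01.
  have yx0 : (y - x0 : I -> V) \in @sqsummable R I V.
    apply/sqsummableP.
    apply: (proj1 (@nsum_le_seq _ _ (sqnorms (y - x0)) (1 ^+ 2) _ _)).
      exact: sqnorms_ge0.
    exact: yF.
  by rewrite -[y](subrK (l2val x0)) rpredD // l2valP.
apply/cvg_ex; exists (L2 yl2); apply/cvgrPdist_lt => e e0.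
have e2 : 0 < e / 2 by rewrite divr_gt0.
have [x0 Fx0] := Fcauchy _ e2.
apply: filterS (Fx0) => x; rewrite -ball_normE /= => xx0.
rewrite -[L2 yl2](subrK x0) -addrA [e]splitr.
apply: (le_lt_trans (ler_normD _ _)); apply: ler_ltD xx0.
rewrite l2_normE -(@ler_pXn2r _ 2) ?nnegrE ?l2norm_ge0 ?(ltW e2) //.
rewrite l2norm_sqr.
apply: (proj2 (@nsum_le_seq _ _ (sqnorms (L2 yl2 - x0)) ((e / 2) ^+ 2) _ _)).
  exact: sqnorms_ge0.
exact: yF.
Qed.

HB.instance Definition _ := Uniform_isComplete.Build (l2 I V) l2_complete.

End Completeness.

Section Polarization.
Variable R : realType.

(** Frechet's identity and a homogeneity identity: being equalities between
sums of squared norms with nonnegative coefficients, they pass to Hilbert sums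
term by term, and together they say that the norm is Euclidean. *)
Definition euclidean (V : normedModType R) : Prop :=
  (forall x y z : V, `|x + y + z| ^+ 2 + (`|x| ^+ 2 + (`|y| ^+ 2 + `|z| ^+ 2))
     = `|x + y| ^+ 2 + (`|x + z| ^+ 2 + `|y + z| ^+ 2)) /\
  (forall (c : R) (x y : V), 0 <= c ->
     `|c *: x + y| ^+ 2 + (c * `|x| ^+ 2 + c * `|y| ^+ 2)
     = c * `|x + y| ^+ 2 + (c ^+ 2 * `|x| ^+ 2 + `|y| ^+ 2)).

Lemma norm_of_dot_euclidean (V : normedModType R) (dot : {dot V for idfun}) :
  norm_of_dot dot -> euclidean V.
Proof.
move=> hV; have dotC x y : dot x y = dot y x.
  by rewrite hermitian_subproof expr0 mul1r.
have dotDl x y z : dot (x + y) z = dot x z + dot y z.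
  by rewrite dotC linearDr /= dotC [dot z y]dotC.
have dotDr x y z : dot z (x + y) = dot z x + dot z y by rewrite linearDr.
have dotZr (c : R) x y : dot x (c *: y) = c * dot x y by rewrite linearZr_LR.
have dotZl (c : R) x y : dot (c *: x) y = c * dot x y.
  by rewrite dotC dotZr dotC.
split=> [x y z|c x y _]; rewrite !hV !(dotDl, dotDr, dotZl, dotZr).
  by rewrite [dot y x]dotC [dot z x]dotC [dot z y]dotC; ring.
by rewrite [dot y x]dotC; ring.
Qed.

Lemma euclidean_norm_of_dot (V : normedModType R) : euclidean V ->
  exists dot : {dot V for idfun}, norm_of_dot dot.
Proof.
move=> [frechet scale].
pose d (x y : V) : R := (`|x + y| ^+ 2 - `|x| ^+ 2 - `|y| ^+ 2) / 2.
have dC x y : d x y = d y x by rewrite /d [x + y]addrC addrAC.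
have dxx x : d x x = `|x| ^+ 2.
  by rewrite /d -mulr2n -scaler_nat normrZ exprMn ger0_norm //; field.
have dD x y z : d (x + y) z = d x z + d y z.
  rewrite /d; have -> : `|x + y + z| ^+ 2 = `|x + y| ^+ 2 + (`|x + z| ^+ 2 +
      `|y + z| ^+ 2) - (`|x| ^+ 2 + (`|y| ^+ 2 + `|z| ^+ 2)).
    by rewrite -frechet; ring.
  by field.
have d0 y : d 0 y = 0 by rewrite /d add0r normr0; field.
have dN x y : d (- x) y = - d x y.
  by apply/eqP; rewrite -addr_eq0 -dD addNr d0.
have dZ_ge0 (c : R) x y : 0 <= c -> d (c *: x) y = c * d x y.
  move=> c0; rewrite /d; have -> : `|c *: x + y| ^+ 2 = c * `|x + y| ^+ 2 +
      (c ^+ 2 * `|x| ^+ 2 + `|y| ^+ 2) - (c * `|x| ^+ 2 + c * `|y| ^+ 2).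
    by rewrite -scale //; ring.
  by rewrite normrZ exprMn real_normK ?num_real //; field.
have dZ (c : R) x y : d (c *: x) y = c * d x y.
  have [c0|c0] := leP 0 c; first exact: dZ_ge0.
  by rewrite -[c]opprK scaleNr dN dZ_ge0 ?mulNr // oppr_ge0 ltW.
have bil : bilinear_for *%R (idfun \; *%R) d.
  by split=> [y c x z|y c x z] /=; rewrite ?dD ?dZ // dC dD dZ ![d _ y]dC.
have herm (x y : V) : d x y = (-1) ^+ false * idfun (d y x).
  by rewrite expr0 mul1r dC.
have pos (x : V) : x != 0 -> 0 < d x x.
  by move=> x0; rewrite dxx exprn_gt0 // normr_gt0.
pose dot : {dot V for idfun} := HB.pack d
  (bilinear_isBilinear.Build R V V R *%R (idfun \; *%R) d bil)
  (isHermitianSesquilinear.Build R V false idfun d herm)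
  (isDotProduct.Build R V d pos).
by exists dot => x; rewrite -dxx.
Qed.

Lemma l2_euclidean (I : choiceType) (V : normedModType R) :
  euclidean V -> euclidean (l2 I V).
Proof.
move=> [frechet scale].
have s0 (f : I -> V) i : 0 <= sqnorms f i by exact: sqnorms_ge0.
have sD (a b : I -> R) : (forall i, 0 <= a i) -> (forall i, 0 <= b i) ->
    forall i, 0 <= a i + b i by move=> a0 b0 i; rewrite addr_ge0.
have sM (c : R) (f : I -> V) : 0 <= c -> forall i, 0 <= c * sqnorms f i.
  by move=> c0 i; rewrite mulr_ge0.
have sum4 (u v w t : l2 I V) : `|u| ^+ 2 + (`|v| ^+ 2 + (`|w| ^+ 2 + `|t| ^+ 2))
    = nsum (fun i => sqnorms u i + (sqnorms v i + (sqnorms w i + sqnorms t i))).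
  have [s1 e1] := nsumD (s0 w) (s0 t) (l2_summable w) (l2_summable t).
  have [s2 e2] := nsumD (s0 v) (sD _ _ (s0 w) (s0 t)) (l2_summable v) s1.
  have [_ e3] := nsumD (s0 u) (sD _ _ (s0 v) (sD _ _ (s0 w) (s0 t)))
    (l2_summable u) s2.
  rewrite e3 e2 e1 (l2_sqnormE u) (l2_sqnormE v) (l2_sqnormE w).
  by rewrite (l2_sqnormE t).
have sum3 (c1 c2 c3 : R) (u v w : l2 I V) : 0 <= c1 -> 0 <= c2 -> 0 <= c3 ->
    c1 * `|u| ^+ 2 + (c2 * `|v| ^+ 2 + c3 * `|w| ^+ 2)
    = nsum (fun i => c1 * sqnorms u i + (c2 * sqnorms v i + c3 * sqnorms w i)).
  move=> c1_ge0 c2_ge0 c3_ge0.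
  have [su eu] := nsumZ c1_ge0 (s0 u) (l2_summable u).
  have [sv ev] := nsumZ c2_ge0 (s0 v) (l2_summable v).
  have [sw ew] := nsumZ c3_ge0 (s0 w) (l2_summable w).
  have [s1 e1] := nsumD (sM _ _ c2_ge0) (sM _ _ c3_ge0) sv sw.
  have [_ e2] := nsumD (sM _ _ c1_ge0) (sD _ _ (sM _ _ c2_ge0) (sM _ _ c3_ge0))
    su s1.
  by rewrite e2 e1 eu ev ew (l2_sqnormE u) (l2_sqnormE v) (l2_sqnormE w).
have sum3' (u v w : l2 I V) : `|u| ^+ 2 + (`|v| ^+ 2 + `|w| ^+ 2)
    = nsum (fun i => 1 * sqnorms u i + (1 * sqnorms v i + 1 * sqnorms w i)).
  by have := sum3 1 1 1 u v w ler01 ler01 ler01; rewrite !mul1r.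
split=> [x y z|c x y c0].
  apply: etrans (sum4 _ _ _ _) (etrans _ (esym (sum3' _ _ _))).
  by congr nsum; apply/funext => i; rewrite 3!mul1r; exact: frechet.
have := sum3 1 c c (c *: x + y) x y ler01 c0 c0; rewrite mul1r => e1.
have := sum3 c (c ^+ 2) 1 (x + y) x y c0 (sqr_ge0 c) ler01; rewrite mul1r => e2.
apply: etrans e1 (etrans _ (esym e2)); congr nsum; apply/funext => i.
by rewrite !mul1r; exact: scale.
Qed.

End Polarization.

(** * Twisted permutation actions on Hilbert sums *)

Section TwistedAction.
Variables (R : realType) (G K : groupType) (I : choiceType).
Variable V : completeNormedModType R.
Variable A : K -> V -> V.
Hypothesis A_action : affine_isometric_action A.
Variables (act : G -> I -> I) (tau : G -> I -> K).
Hypothesis act1 : forall i, act 1%g i = i.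
Hypothesis actM : forall g h i, act (g * h)%g i = act g (act h i).
Hypothesis tauM :
  forall g h i, tau (g * h)%g i = (tau g i * tau h (act g^-1%g i))%g.
Variable Phi : G -> I -> V.
Hypothesis PhiM :
  forall g h i, Phi (g * h)%g i = A (tau g i) (Phi h (act g^-1%g i)).
Hypothesis Phi_l2 : forall g, (Phi g - Phi 1%g : I -> V) \in @sqsummable R I V.

Let A1 v : A 1%g v = v. Proof. by case: A_action. Qed.
Let AM k l v : A (k * l)%g v = A k (A l v). Proof. by case: A_action. Qed.
Let A_isom k v w : `|A k v - A k w| = `|v - w|. Proof. by case: A_action. Qed.

Let A_linear k (c : R) v w :
  A k (c *: v + w) - A k 0 = c *: (A k v - A k 0) + (A k w - A k 0).
Proof.
have [_ _ /(_ k)[L [b AE]] _] := A_action.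
by rewrite !AE linear0 add0r !addrK linearP.
Qed.

Let A_add k v w : A k (v + w) = A k v - A k 0 + A k w.
Proof.
by have := A_linear k 1 v w; rewrite !scale1r addrA => /addIr ->.
Qed.

Let act_bij g : bijective (act g).
Proof.
by exists (act g^-1%g) => i; rewrite -actM ?mulVg ?mulgV act1.
Qed.

Let tau1 i : tau 1%g i = 1%g.
Proof.
apply: (@mulgI _ (tau 1%g i)); rewrite mulg1.
by have := tauM 1%g 1%g i; rewrite mulg1 invg1 act1 => <-.
Qed.

Definition twist_fun g (x : I -> V) : I -> V :=
  fun i => A (tau g i) (x (act g^-1%g i)) - A (tau g i) 0.

Let twist_l2 g (x : l2 I V) : twist_fun g x \in @sqsummable R I V.
Proof.
apply/sqsummableP.
have -> : sqnorms (twist_fun g x) = sqnorms x \o act g^-1%g.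
  by apply/funext => i; rewrite /sqnorms /= A_isom subr0.
exact: nsummable_reindex (l2_summable x).
Qed.

Definition twist g (x : l2 I V) : l2 I V := L2 (twist_l2 g x).

Lemma twist_is_linear g : linear (twist g).
Proof. by move=> c x y; apply: l2P => i; exact: A_linear. Qed.

Lemma twist_norm g x : `|twist g x| = `|x|.
Proof.
rewrite !l2_normE /l2norm; congr Num.sqrt.
rewrite -[RHS](nsum_reindex _ (act_bij g^-1%g)); congr nsum; apply/funext => i.
by rewrite /sqnorms /= A_isom subr0.
Qed.

(** The values of [Phi] need not be square-summable, only their differences
are: [Phi 1] serves as the origin. *)
Definition cocycle g : l2 I V := L2 (Phi_l2 g).

Lemma cocycleE g i : cocycle g i = Phi g i - Phi 1%g i.
Proof. by []. Qed.

Definition twisted_action g (x : l2 I V) : l2 I V := twist g x + cocycle g.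

(** The affine action is the formal action on all functions [I -> V],
conjugated by the translation by [Phi 1]. *)
Lemma twisted_actionE g x i : twisted_action g x i =
  A (tau g i) (x (act g^-1%g i) + Phi 1%g (act g^-1%g i)) - Phi 1%g i.
Proof.
rewrite /twisted_action l2DE cocycleE A_add.
by have := PhiM g 1%g i; rewrite mulg1 => <-; rewrite addrA.
Qed.

Lemma twisted_action_isometric : affine_isometric_action twisted_action.
Proof.
split=> [x|g h x|g|g x y].
- apply: l2P => i; rewrite twisted_actionE invg1 act1 tau1 A1.
  by rewrite addrK.
- apply: l2P => i; rewrite !twisted_actionE subrK -AM -tauM.
  by rewrite invgM actM.
- pose L : {linear l2 I V -> l2 I V} := HB.pack (twist g)
    (GRing.isLinear.Build R (l2 I V) (l2 I V) *:%R (twist g)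
       (twist_is_linear g)).
  by exists L, (cocycle g).
- rewrite /twisted_action opprD addrACA subrr addr0.
  have twistB : twist g (x - y) = twist g x - twist g y.
    by rewrite addrC -scaleN1r twist_is_linear scaleN1r addrC.
  by rewrite -twistB twist_norm.
Qed.

Lemma cocycle_equivariant g h :
  cocycle (g * h)%g = twisted_action g (cocycle h).
Proof. by apply: l2P => i; rewrite twisted_actionE !cocycleE subrK PhiM. Qed.

End TwistedAction.

(** * Word metrics *)

Section WordLength.
Variables (G : groupType) (S : seq G) (hS : generates S).
Local Notation len := (word_length hS).

Lemma word_length_spells g : exists2 w, spells S g w & size w = len g.
Proof. by rewrite /word_length; case: ex_minnP => n /asboolP. Qed.

Lemma word_length_le g w : spells S g w -> (len g <= size w)%N.
Proof.
rewrite /word_length; case: ex_minnP => n _ min_n gw.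
by apply: min_n; apply/asboolP; exists w.
Qed.

Lemma word_length1 : len 1%g = 0%N.
Proof. by apply/eqP; rewrite -leqn0; exact: (word_length_le (spells1 S)). Qed.

Lemma word_length_eq0 g : len g = 0%N -> g = 1%g.
Proof.
by have [w [_ <-] <-] := word_length_spells g => /size0nil ->; rewrite big_nil.
Qed.

Lemma word_lengthM g h : (len (g * h)%g <= len g + len h)%N.
Proof.
have [v gv <-] := word_length_spells g; have [w hw <-] := word_length_spells h.
by rewrite -size_cat; exact/word_length_le/spellsM.
Qed.

Lemma word_lengthV g : (len g^-1%g <= len g)%N.
Proof.
have [w gw <-] := word_length_spells g.
by have := word_length_le (spellsV gw); rewrite size_rev size_map.
Qed.

Lemma word_dist1 g : word_dist hS 1%g g = len g.
Proof. by rewrite /word_dist invg1 mul1g. Qed.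

(** A subadditive quantity is bounded on the finitely many generators and their
inverses, hence grows at most linearly in the word length. *)
Lemma linear_growth (P : G -> nat -> Prop) :
    P 1%g 0%N ->
    (forall g h m n, P g m -> P h n -> P (g * h)%g (m + n)%N) ->
    (forall g m n, (m <= n)%N -> P g m -> P g n) ->
    (forall g, exists n, P g n) ->
  exists D, forall g, P g (D * len g)%N.
Proof.
move=> P1 PM Pmono Pex.
have [D PD] : exists D, forall x, x \in S ++ map (fun y => y^-1%g) S -> P x D.
  elim: (S ++ _) => [|x s [D PD]]; first by exists 0%N.
  have [n Pn] := Pex x; exists (maxn n D) => y.
  rewrite inE => /predU1P[->|/PD].
    exact: Pmono (leq_maxl _ _) Pn.
  exact: Pmono (leq_maxr _ _).
exists D => g; have [w [Sw <-] <-] := word_length_spells g.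
elim: w Sw => [|x w IHw] /=; first by rewrite big_nil muln0.
case/andP => Sx /IHw Pw; rewrite big_cons mulnS; apply: PM => //.
apply: PD; rewrite mem_cat; case/orP: Sx => [->//|Sx].
by apply/orP; right; apply/mapP; exists x^-1%g; rewrite ?invgK.
Qed.

Lemma equivariant_lipschitz (R : realType) (V : normedModType R)
    (A : G -> V -> V) (f : G -> V) :
    affine_isometric_action A -> (forall g x, f (g * x)%g = A g (f x)) ->
  exists2 C : R, 0 < C &
    forall x y, `|f x - f y| <= C * (word_dist hS x y)%:R.
Proof.
move=> [_ _ _ A_isom] fA.
have [|g h m n gm hn|g m n mn|g|D fD] :=
    @linear_growth (fun g n => `|f g - f 1%g| <= n%:R).
- by rewrite subrr normr0.
- rewrite -(subrK (f g) (f (g * h)%g)) -addrA.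
  apply: (le_trans (ler_normD _ _)); rewrite addnC natrD lerD //.
  by rewrite fA -{2}[g]mulg1 fA A_isom.
- by move=> /le_trans; apply; rewrite ler_nat.
- by exists (Num.bound `|f g - f 1%g|); apply/ltW/archi_boundP.
exists D.+1%:R; rewrite ?ltr0n // => x y.
have -> : `|f x - f y| = `|f (x^-1 * y)%g - f 1%g|.
  by rewrite -(A_isom x (f (x^-1 * y)%g)) -!fA mulVKg mulg1 distrC.
by apply: (le_trans (fD _)); rewrite -natrM ler_nat leq_mul2r leqnSn orbT.
Qed.

End WordLength.

(** * The lamp group inside the wreath product *)

Section LampGroup.
Variable H : groupType.
Implicit Types (h : H) (g : wreathZ H).

Lemma wreath_base1 : wreath_base 1%g = 1%g :> wreathZ H.
Proof.
by apply: wreathP => // x; rewrite /= lamps_singleE lampsE; case: ifP.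
Qed.

Lemma wreath_baseM h k :
  wreath_base (h * k)%g = (wreath_base h * wreath_base k)%g.
Proof.
apply: wreathP => // x; rewrite /= !lampsE !lamps_singleE subr0.
by case: ifP => // _; rewrite mulg1.
Qed.

Lemma wreath_baseV h : wreath_base h^-1%g = (wreath_base h)^-1%g.
Proof.
by apply: (@mulgI _ (wreath_base h)); rewrite -wreath_baseM !mulgV wreath_base1.
Qed.

Lemma lamp_base h : lamp_at (lamp (wreath_base h)) 0 = h.
Proof. by rewrite lamps_singleE eqxx. Qed.

Lemma wreath_base_inj : injective (@wreath_base H).
Proof. by move=> h k hk; rewrite -(lamp_base h) hk lamp_base. Qed.

Lemma lampM g k x : lamp_at (lamp (g * k)%g) x =
  (lamp_at (lamp g) x * lamp_at (lamp k) (x - cursor g))%g.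
Proof. by rewrite wreath_mulE /= !lampsE. Qed.

Lemma lampV g x :
  lamp_at (lamp g^-1%g) x = (lamp_at (lamp g) (x + cursor g))^-1%g.
Proof. by rewrite /= !lampsE opprK. Qed.

Lemma cursorM g k : cursor (g * k)%g = cursor g + cursor k. Proof. by []. Qed.

Lemma cursorV g : cursor g^-1%g = - cursor g. Proof. by []. Qed.

Lemma lamp1 x : lamp_at (lamp (1%g : wreathZ H)) x = 1%g.
Proof. exact: lamps_oneE. Qed.

Variables (S : seq H) (hS : generates S) (T : seq (wreathZ H)).
Hypothesis hT : generates T.

Lemma lamp_length_le : exists D, forall g x,
  (word_length hS (lamp_at (lamp g) x) <= D * word_length hT g)%N.
Proof.
have [x|g k m n gm kn x|g m n mn gm x|g|D] := @linear_growth _ _ hT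
    (fun g n => forall x, (word_length hS (lamp_at (lamp g) x) <= n)%N).
- by rewrite lamp1 word_length1.
- by rewrite lampM; apply: (leq_trans (word_lengthM _ _ _)); exact: leq_add.
- exact: leq_trans mn.
- exists (\sum_(x <- finsupp (lamp g : {fsfun int -> H with 1%g}))
    word_length hS (lamp_at (lamp g) x))%N => x.
  have [xg|xg] := boolP (x \in finsupp (lamp g : {fsfun int -> H with 1%g})).
    by rewrite (big_rem x xg) /= leq_addr.
  by rewrite /lamp_at fsfun_dflt // word_length1.
by exists D.
Qed.

Lemma base_length_le : exists D, forall h,
  (word_length hT (wreath_base h) <= D * word_length hS h)%N.
Proof.
have [|h k m n hm kn|h m n mn hm|h|D] := @linear_growth _ _ hS
    (fun h n => (word_length hT (wreath_base h) <= n)%N).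
- by rewrite wreath_base1 word_length1.
- rewrite wreath_baseM; apply: (leq_trans (word_lengthM _ _ _)).
  exact: leq_add.
- exact: leq_trans mn.
- by eexists.
by exists D.
Qed.

(** The lamp group is undistorted in the wreath product, so compression
exponents restrict to it. *)
Lemma equivariant_exponents_wreath (R : realType) :
  @equivariant_exponents R _ _ hT `<=` @equivariant_exponents R _ _ hS.
Proof.
move=> a [a01 [V [dot [A [f [hV A_action fA [C1 [C2 [C1_gt0 _ fbounds]]]]]]]]].
split=> //; exists V, dot, (A \o @wreath_base H), (f \o @wreath_base H).
have base_action : affine_isometric_action (A \o @wreath_base H).
  case: A_action => A1 AM A_aff A_isom; split=> [v|h k v|h|h v w] /=.
  - by rewrite wreath_base1 A1.
  - by rewrite wreath_baseM AM.
  - exact: A_aff.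
  - exact: A_isom.
have base_equivariant h k : (f \o @wreath_base H) (h * k)%g =
    (A \o @wreath_base H) h ((f \o @wreath_base H) k).
  by rewrite /= wreath_baseM fA.
split=> //; have [C C_gt0 f_lip] :=
  equivariant_lipschitz hS base_action base_equivariant.
have [D lamp_le] := lamp_length_le.
have D_gt0 : (0 : R) < D.+1%:R `^ a by apply: powR_gt0; rewrite ltr0n.
exists (C1 / (D.+1%:R : R) `^ a), C; split=> // [|h k]; first exact: divr_gt0.
split=> [hk|]; last exact: f_lip.
have [/(_ (contra_neq (@wreath_base_inj h k) hk)) f_ge _] :=
  fbounds (wreath_base h) (wreath_base k).
apply: le_trans f_ge; rewrite -mulrA ler_pM2l // ler_pdivrMl // -powRM //.
apply: ge0_ler_powR; rewrite ?nnegrE ?mulr_ge0 //; first by case/andP: a01.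
rewrite -natrM ler_nat /word_dist -wreath_baseV -wreath_baseM.
have := lamp_le (wreath_base (h^-1 * k)%g) 0; rewrite lamp_base.
by move=> /leq_trans -> //; rewrite leq_mul2r leqnSn orbT.
Qed.

End LampGroup.

Section WreathLength.
Variables (H : groupType) (S : seq H) (hS : generates S).
Variables (T : seq (wreathZ H)) (hT : generates T).
Local Notation len := (word_length hT).
Implicit Types (g : wreathZ H) (l : lamps H).

Lemma translation_length_le (n : int) :
  (len (Wreath 1%g n) <= len (wreath_gen H) * `|n|)%N.
Proof.
have pos (k : nat) : (len (Wreath 1%g k%:Z) <= len (wreath_gen H) * k)%N.
  elim: k => [|k IHk].
    by rewrite muln0 leqn0; apply/eqP; exact: word_length1.
  have -> : Wreath 1%g k.+1%:Z = (wreath_gen H * Wreath 1%g k%:Z)%g.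
    by apply: wreathP => [x|] /=; rewrite ?lampsE ?mulg1 // intS.
  by rewrite mulnS; apply: (leq_trans (word_lengthM _ _ _)); rewrite leq_add2l.
case: n => k; first exact: pos.
have -> : Wreath 1%g (Negz k) = ((Wreath 1%g k.+1%:Z : wreathZ H)^-1)%g.
  by apply: wreathP => [x|] //=; rewrite !lampsE invg1.
exact: leq_trans (word_lengthV _ _) (pos _).
Qed.

(** Walking from [0] to [k] and setting each lamp on the way. *)
Lemma sweep_length_le (k : nat) l :
    (forall x, (x < 0) || (k%:Z < x) -> lamp_at l x = 1%g) ->
  (len (Wreath l k%:Z) <=
     len (wreath_gen H) * k +
     \sum_(i < k.+1) len (wreath_base (lamp_at l i%:Z)))%N.
Proof.
elim: k l => [|k IHk] l lk.
  rewrite big_ord1 muln0 add0n.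
  have -> // : Wreath l 0%:Z = wreath_base (lamp_at l 0).
  apply: wreathP => // x /=; rewrite lamps_singleE.
  have [->//|x0] := eqVneq x 0; apply: lk; lia.
have [l' l'E] : exists l' : lamps H,
    forall x, lamp_at l' x = if x == - 1 then 1%g else lamp_at l (x + 1).
  exists (lamps_shift (- 1) ((lamps_single 0 (lamp_at l 0))^-1 * l)%g) => x.
  rewrite !lampsE opprK lamps_singleE addr_eq0.
  have [->|xN1] := eqVneq x (- 1); first by rewrite addNr mulVg.
  by rewrite invg1 mul1g.
have -> : Wreath l k.+1%:Z =
    (wreath_base (lamp_at l 0%:Z) * wreath_gen H * Wreath l' k%:Z)%g.
  apply: wreathP => [x|] /=; last by rewrite add0r intS.
  rewrite !lampsE lamps_singleE l'E mulg1 add0r subr_eq addNr subrK.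
  by have [->|x0] := eqVneq x 0; rewrite ?mulg1 ?mul1g.
rewrite big_ord_recl mulnS.
have IH : (len (Wreath l' k%:Z) <= len (wreath_gen H) * k +
    \sum_(i < k.+1) len (wreath_base (lamp_at l (lift ord0 i)%:Z)))%N.
  have -> : (\sum_(i < k.+1) len (wreath_base (lamp_at l (lift ord0 i)%:Z)) =
      \sum_(i < k.+1) len (wreath_base (lamp_at l' i%:Z)))%N.
    by apply: eq_bigr => i _; rewrite l'E /= intS addrC.
  by apply: IHk => x xk; rewrite l'E; case: eqP => // /eqP xN1; apply: lk; lia.
apply: (leq_trans (word_lengthM _ _ _)).
apply: (leq_trans (leq_add (word_lengthM _ _ _) IH)).
have rearrange (a b c d : nat) : (a + b + (c + d) = b + c + (a + d))%N by lia.
by rewrite rearrange.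
Qed.

(** An element is reached by walking to the left end of an interval containing
its support, sweeping the interval, and walking back to the cursor. *)
Lemma wreath_length_le : exists C, forall g (m p : nat),
    (forall x, (x < - m%:Z) || (p%:Z < x) -> lamp_at (lamp g) x = 1%g) ->
    - m%:Z <= cursor g <= p%:Z ->
  (len g <= C * (m + p + \sum_(i < (m + p).+1)
     word_length hS (lamp_at (lamp g) (i%:Z - m%:Z))))%N.
Proof.
have [D base_le] := base_length_le hS hT.
set c := len (wreath_gen H); exists (3 * c + D)%N => g m p g_supp g_cursor.
pose l := lamps_shift m%:Z (lamp g).
have gE : g = (Wreath 1%g (- m%:Z) * Wreath l (m + p)%:Z *
               Wreath 1%g (cursor g - p%:Z))%g.
  apply: wreathP => [x|]; last by rewrite /= PoszD; lia.
  by rewrite /= !lampsE mulg1 mul1g opprK addrK.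
rewrite {1}gE {gE}.
apply: (leq_trans (word_lengthM _ _ _)).
have := word_lengthM hT (Wreath 1%g (- m%:Z)) (Wreath l (m + p)%:Z).
have := translation_length_le (- m%:Z).
have := translation_length_le (cursor g - p%:Z).
have : (len (Wreath l (m + p)%:Z) <= c * (m + p) + D * \sum_(i < (m + p).+1)
     word_length hS (lamp_at (lamp g) (i%:Z - m%:Z)))%N.
  apply: (leq_trans (sweep_length_le _)) => [x xmp|].
    by rewrite !lampsE; apply: g_supp; lia.
  rewrite leq_add2l big_distrr /=; apply: leq_sum => i _.
  by rewrite lampsE; exact: base_le.
set N := (\sum_(i < _) _)%N => le_mid le_end le_start le_prod.
have {}le_end : (len (Wreath 1%g (cursor g - p%:Z)) <= c * (m + p))%N.
  by apply: (leq_trans le_end); rewrite leq_mul2l; apply/orP; right; lia.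
have {}le_start : (len (Wreath 1%g (- m%:Z)) <= c * (m + p))%N.
  by apply: (leq_trans le_start); rewrite leq_mul2l; apply/orP; right; lia.
have := leq_add (leq_trans le_prod (leq_add le_start le_mid)) le_end.
move=> /leq_trans; apply.
have sum_up (M : nat) :
  (c * M + (c * M + D * N) + c * M <= (3 * c + D) * (M + N))%N by nia.
exact: sum_up.
Qed.

End WreathLength.

(** * Half-spaces of the wreath product *)

Section HalfSpaces.
Variable H : groupType.
Local Notation Gam := (wreathZ H).
Implicit Types (g y : Gam) (s : bool) (p : nat) (A : set Gam).

Definition orient s (x : int) : int := if s then - x else x.

(** Right multiplication by [wreath_base h] changes only the lamp at the cursor,
and right multiplication by [wreath_gen] moves the cursor by one, so a path
along these generators leaves this set only when its cursor moves beyond [p]: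
half-spaces measure the range of the cursor. *)
Definition halfspace s p : set Gam :=
  [set g | orient s (cursor g) <= p%:Z /\
           forall x, p%:Z < orient s x -> lamp_at (lamp g) x = 1%g].

Definition translate g A : set Gam := [set y | A (g^-1 * y)%g].

Definition wall s : set (set Gam) :=
  [set A | exists y, A = translate y (halfspace s 0)].

Lemma translate1 A : translate 1%g A = A.
Proof. by apply/seteqP; split=> y; rewrite /translate /= invg1 mul1g. Qed.

Lemma translateM g y A : translate (g * y)%g A = translate g (translate y A).
Proof. by apply/seteqP; split=> z; rewrite /translate /= invgM mulgA. Qed.

Lemma translateV_mem g y A : translate g^-1%g A y = A (g * y)%g.
Proof. by rewrite /translate /= invgK. Qed.

Lemma translateVK g A : translate g (translate g^-1%g A) = A.
Proof. by rewrite -translateM mulgV translate1. Qed.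

Lemma wall_translate s g A : wall s A -> wall s (translate g A).
Proof. by move=> [y ->]; exists (g * y)%g; rewrite translateM. Qed.

Lemma wall_translateV s g A : wall s (translate g^-1%g A) <-> wall s A.
Proof.
split=> [/(wall_translate g)|]; first by rewrite translateVK.
exact: wall_translate.
Qed.

Lemma halfspace_mono s p q : (p <= q)%N -> halfspace s p `<=` halfspace s q.
Proof.
move=> pq g [g_cursor g_lamp]; split=> [|x qx]; first by lia.
by apply: g_lamp; lia.
Qed.

Lemma halfspace1 s p : halfspace s p 1%g.
Proof. by split=> [|x _]; [case: (s)|exact: lamp1]. Qed.

(** Lamps on the side that a half-space ignores act trivially on it, so a
translate depends on the cursor only. *)
Lemma translate_halfspace s y p : orient s (cursor y) = p%:Z ->
    (forall x, p%:Z < orient s x -> lamp_at (lamp y) x = 1%g) ->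
  translate y (halfspace s 0) = halfspace s p.
Proof.
move=> yp y_lamp.
have lampE g x : lamp_at (lamp (y^-1 * g)%g) x =
    ((lamp_at (lamp y) (x + cursor y))^-1 * lamp_at (lamp g) (x + cursor y))%g.
  by rewrite lampM lampV cursorV opprK.
apply/seteqP; split=> g [] /=; rewrite ?cursorM ?cursorV => g_cursor g_lamp.
  split=> [|x px]; first by move: g_cursor yp; rewrite /orient; case: (s); lia.
  have := g_lamp (x - cursor y); rewrite lampE subrK y_lamp // invg1 mul1g.
  by apply; move: px yp; rewrite /orient; case: (s); lia.
split=> [|x px].
  rewrite ?cursorM ?cursorV; move: g_cursor yp.
  by rewrite /orient; case: (s); lia.
rewrite lampE y_lamp ?g_lamp ?mulVg //; move: px yp;
  rewrite /orient; case: (s); lia.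
Qed.

Lemma wall_halfspace s p : wall s (halfspace s p).
Proof.
exists (Wreath 1%g (orient s p%:Z)); apply/esym/translate_halfspace => [|x _].
  by rewrite /orient /=; case: (s); rewrite ?opprK.
exact: lamps_oneE.
Qed.

Lemma wall_mem1 s A : wall s A -> A 1%g -> exists p, A = halfspace s p.
Proof.
move=> [y ->]; rewrite /translate /= mulg1 => -[y_cursor y_lamp].
exists `|cursor y|%N; apply: translate_halfspace => [|x yx].
  by move: y_cursor; rewrite /= /orient; case: (s); lia.
have := y_lamp (x - cursor y); rewrite lampV subrK => y1.
apply: (can_inj (@invgK H)); rewrite invg1; apply: y1.
by move: y_cursor yx; rewrite /= /orient; case: (s); lia.
Qed.

Lemma halfspace_inj s : injective (halfspace s).
Proof.
have le p q : halfspace s p = halfspace s q -> (p <= q)%N.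
  move=> pq; have : halfspace s p (Wreath 1%g (orient s p%:Z)).
    split=> [|x _]; last exact: lamps_oneE.
    by rewrite /orient /=; case: (s); rewrite ?opprK.
  by rewrite pq => -[/=]; rewrite /orient; case: (s); lia.
by move=> p q pq; apply/eqP; rewrite eqn_leq !le.
Qed.

Lemma halfspace_ex s g : exists p, `[< halfspace s p g >].
Proof.
pose r := (\sum_(x <- finsupp (lamp g : {fsfun int -> H with 1%g})) `|x|)%N.
exists (`|cursor g| + r)%N; apply/asboolP; split=> [|x rx].
  by rewrite /orient; case: (s); lia.
apply: fsfun_dflt; apply/negP => xg.
have : (`|x| <= r)%N by rewrite /r (big_rem x xg) /= leq_addr.
by move: rx; rewrite /orient; case: (s); lia.
Qed.

(** How far [g] extends in the direction [s]; by minimality, this is the number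
of half-spaces of this direction that contain [1] and not [g]. *)
Definition reach s g : nat := ex_minn (halfspace_ex s g).

Lemma halfspace_reach s g p : halfspace s p g <-> (reach s g <= p)%N.
Proof.
rewrite /reach; case: ex_minnP => m /asboolP gm min_m; split=> [gp|mp].
  by apply: min_m; apply/asboolP.
exact: halfspace_mono mp _ gm.
Qed.

Lemma reach_support g x :
  (x < - (reach true g)%:Z) || ((reach false g)%:Z < x) ->
  lamp_at (lamp g) x = 1%g.
Proof.
have [_ g_left] := (halfspace_reach true g _).2 (leqnn _).
have [_ g_right] := (halfspace_reach false g _).2 (leqnn _).
by case/orP=> gx; [apply: g_left|apply: g_right]; rewrite /orient //; lia.
Qed.

Lemma reach_cursor g :
  - (reach true g)%:Z <= cursor g <= (reach false g)%:Z.
Proof.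
have [g_left _] := (halfspace_reach true g _).2 (leqnn _).
have [g_right _] := (halfspace_reach false g _).2 (leqnn _).
by move: g_left g_right; rewrite /orient; lia.
Qed.

Lemma wall_separating s A g : wall s A -> A 1%g -> ~ A g ->
  exists2 p, (p < reach s g)%N & A = halfspace s p.
Proof.
move=> wA A1 Ag; have [p Ap] := wall_mem1 wA A1; exists p => //.
by rewrite ltnNge; apply/negP => /halfspace_reach; rewrite -Ap.
Qed.

End HalfSpaces.

(** * The embedding of the wreath product *)

Section Embedding.
Variables (R : realType) (H : groupType) (V : completeNormedModType R).
Variables (A : H -> V -> V) (f : H -> V) (u : V).
Hypothesis A_action : affine_isometric_action A.
Hypothesis fA : forall g x, f (g * x)%g = A g (f x).
Hypothesis u1 : `|u| = 1.
Local Notation Gam := (wreathZ H).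

(** Lamp positions, and oriented sets of elements: the latter index the
half-spaces, on which the group acts by left translation. *)
Definition site : choiceType := (int + bool * set Gam)%type.

Definition site_act (g : Gam) (i : site) : site :=
  match i with
  | inl x => inl (x + cursor g)
  | inr (s, B) => inr (s, translate g B)
  end.

Definition site_twist (g : Gam) (i : site) : H :=
  if i is inl x then lamp_at (lamp g) x else 1%g.

Definition site_field (g : Gam) (i : site) : V :=
  match i with
  | inl x => f (lamp_at (lamp g) x)
  | inr (s, B) => if `[< wall s B /\ B g >] then u else 0
  end.

Lemma site_act1 i : site_act 1%g i = i.
Proof. by case: i => [x|[s B]] /=; rewrite ?addr0 ?translate1. Qed.

Lemma site_actM g h i : site_act (g * h)%g i = site_act g (site_act h i).
Proof.
case: i => [x|[s B]] /=; last by rewrite translateM.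
by rewrite -addrA [cursor h + _]addrC.
Qed.

Lemma site_twistM g h i :
  site_twist (g * h)%g i =
    (site_twist g i * site_twist h (site_act g^-1%g i))%g.
Proof. by case: i => [x|[s B]] /=; rewrite ?mulg1 // lampM. Qed.

Lemma site_fieldM g h i :
  site_field (g * h)%g i =
    A (site_twist g i) (site_field h (site_act g^-1%g i)).
Proof.
case: i => [x|[s B]] /=; first by rewrite -fA -lampM.
case: A_action => -> _ _ _; congr (if _ then u else 0).
by apply: asbool_equiv_eq; rewrite wall_translateV translateV_mem.
Qed.

Definition site_support (g : Gam) : seq site :=
  [seq inl x | x <- finsupp (lamp g : {fsfun int -> H with 1%g})] ++
  [seq inr (s, @halfspace H s p) |
     s <- [:: false; true], p <- iota 0 (reach s g)] ++
  [seq inr (s, translate g (@halfspace H s p)) |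
     s <- [:: false; true], p <- iota 0 (reach s g^-1%g)].

(** A half-space containing [g] and not [1] is the translate by [g] of one
containing [1] and not [g^-1]: only finitely many half-spaces separate [1]
from [g]. *)
Lemma site_supportP g i : i \notin site_support g ->
  site_field g i - site_field 1%g i = 0.
Proof.
move=> ig; apply/eqP; rewrite subr_eq0; apply/eqP; move: ig.
rewrite 2!mem_cat 2!negb_or => /and3P[].
case: i => [x|[s B]] xg g_sep sep_g; rewrite /site_field.
  rewrite lamp1 [lamp_at _ x]fsfun_dflt //; apply: contraNN xg.
  exact: map_f.
have s_in : s \in [:: false; true] by case: (s).
congr (if _ then u else 0); apply: asbool_equiv_eq.
split=> -[wB Bx]; split=> //.
  apply: contrapT => B1; move/negP: sep_g; apply; apply/allpairsPdep.
  have [| | |p pg Bp] := @wall_separating _ s (translate g^-1%g B) g^-1%g.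
  - exact: wall_translate.
  - by rewrite translateV_mem mulg1.
  - by rewrite translateV_mem mulgV.
  by exists s, p; rewrite mem_iota add0n -Bp translateVK.
apply: contrapT => Bg; move/negP: g_sep; apply; apply/allpairsPdep.
have [p pg ->] := wall_separating wB Bx Bg.
by exists s, p; rewrite mem_iota add0n.
Qed.

Lemma site_field_l2 g :
  (site_field g - site_field 1%g : site -> V) \in @sqsummable R site V.
Proof.
apply/sqsummableP; apply: (@nsummable_finite _ _ _ (site_support g)) => i.
  exact: sqnorms_ge0.
move=> /site_supportP gi; rewrite /sqnorms.
by rewrite [X in `|X|]gi normr0 expr0n.
Qed.

Definition embedding (g : Gam) : l2 site V := cocycle site_field_l2 g.

Lemma embeddingE g i : embedding g i = site_field g i - site_field 1%g i.
Proof. exact: cocycleE. Qed.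

Definition embedding_action : Gam -> l2 site V -> l2 site V :=
  twisted_action A_action site_twist site_act1 site_actM site_field_l2.

Lemma embedding_action_isometric : affine_isometric_action embedding_action.
Proof. exact: (twisted_action_isometric _ _ _ site_twistM site_fieldM). Qed.

Lemma embedding_equivariant g x :
  embedding (g * x)%g = embedding_action g (embedding x).
Proof. exact: (cocycle_equivariant _ _ _ site_fieldM). Qed.

(** Both families of sites contribute: half-spaces count the range of the
cursor, lamp positions see the embedding of each lamp. *)
Lemma embedding_norm_ge g (s : seq int) : uniq s ->
  (reach true g + reach false g)%:R +
    \sum_(x <- s) `|f (lamp_at (lamp g) x) - f 1%g| ^+ 2 <= `|embedding g| ^+ 2.
Proof.
move=> us.
pose walls b : seq site :=
  [seq inr (b, @halfspace H b p) | p <- iota 0 (reach b g)].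
have walls_uniq b : uniq (walls b).
  rewrite map_inj_uniq ?iota_uniq // => p q [].
  exact: halfspace_inj.
have walls_sum b : \sum_(i <- walls b) `|embedding g i| ^+ 2 = (reach b g)%:R.
  rewrite big_map (eq_big_seq (fun=> 1)) => [|p].
    by rewrite big_const_seq count_predT size_iota iter_addr_0.
  rewrite mem_iota add0n => /andP[_ pg]; rewrite embeddingE /site_field.
  rewrite asboolF => [|[_ /halfspace_reach]]; last by rewrite leqNgt pg.
  rewrite asboolT; last by split; [exact: wall_halfspace|exact: halfspace1].
  by rewrite sub0r normrN u1 expr1n.
have lamps_sum : \sum_(i <- [seq inl x | x <- s]) `|embedding g i| ^+ 2 =
    \sum_(x <- s) `|f (lamp_at (lamp g) x) - f 1%g| ^+ 2.
  rewrite big_map; apply: eq_bigr => x _.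
  by rewrite embeddingE /site_field lamp1.
rewrite natrD -!walls_sum -lamps_sum -addrA -!big_cat; apply: l2norm_ge_seq.
rewrite cat_uniq walls_uniq cat_uniq walls_uniq map_inj_uniq ?us => [|x y []//].
rewrite andbT; apply/and3P; split=> //; apply/hasPn => i.
  by rewrite mem_cat => /orP[] /mapP[? _ ->]; apply/negP => /mapP[? _].
by move=> /mapP[? _ ->]; apply/negP => /mapP[? _].
Qed.

End Embedding.

(** * Compression exponents *)

Section SubadditivePower.
Variables (R : realType) (p : R).
Hypothesis p01 : 0 < p <= 1.

(** After dividing by the sum, the two terms are fractions of [1], which a power
at most [1] does not decrease. *)
Lemma powR_subadd (x y : R) : 0 <= x -> 0 <= y ->
  (x + y) `^ p <= x `^ p + y `^ p.
Proof.
case/andP: p01 => p0 p1 x0 y0.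
have [xy0|xyN0] := eqVneq (x + y) 0.
  by rewrite xy0 powR0 ?gt_eqF // addr_ge0 // powR_ge0.
have z0 : 0 < x + y by rewrite lt_neqAle eq_sym xyN0 addr_ge0.
have le_frac (t : R) : 0 <= t <= x + y -> t / (x + y) <= (t / (x + y)) `^ p.
  case/andP => t0 tz; have [->|tN0] := eqVneq t 0.
    by rewrite mul0r powR_ge0.
  apply: ger1_powR => //; rewrite ler_pdivrMr // mul1r tz andbT.
  by rewrite divr_gt0 // lt_neqAle eq_sym tN0.
have powE (t : R) : 0 <= t -> t `^ p = (x + y) `^ p * (t / (x + y)) `^ p.
  by move=> t0; rewrite -powRM ?divr_ge0 ?(ltW z0) // mulrCA divff // mulr1.
rewrite (powE x x0) (powE y y0) -mulrDr ler_peMr ?powR_ge0 //.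
have xz : 0 <= x <= x + y by rewrite x0 lerDl.
have yz : 0 <= y <= x + y by rewrite y0 lerDr.
by rewrite -(divff xyN0) mulrDl lerD ?le_frac.
Qed.

Lemma powR_sum_le (I : Type) (s : seq I) (t : I -> R) : (forall i, 0 <= t i) ->
  (\sum_(i <- s) t i) `^ p <= \sum_(i <- s) t i `^ p.
Proof.
move=> t0; elim: s => [|i s IHs].
  by case/andP: p01 => p0 _; rewrite !big_nil powR0 ?gt_eqF.
rewrite !big_cons; apply: (le_trans (powR_subadd _ _)) => //.
  exact: sumr_ge0.
by rewrite lerD2l.
Qed.

End SubadditivePower.

Section LowerBound.
Variables (R : realType) (H : groupType) (S : seq H) (hS : generates S).
Variables (T : seq (wreathZ H)) (hT : generates T).

Lemma real_line_euclidean : euclidean (R^o : normedModType R).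
Proof.
have frechet (x y z : R) :
    `|x + y + z| ^+ 2 + (`|x| ^+ 2 + (`|y| ^+ 2 + `|z| ^+ 2))
    = `|x + y| ^+ 2 + (`|x + z| ^+ 2 + `|y + z| ^+ 2).
  by rewrite !real_normK ?num_real //; ring.
have scale (c x y : R) : `|c * x + y| ^+ 2 + (c * `|x| ^+ 2 + c * `|y| ^+ 2)
     = c * `|x + y| ^+ 2 + (c ^+ 2 * `|x| ^+ 2 + `|y| ^+ 2).
  by rewrite !real_normK ?num_real //; ring.
by split=> [|c x y _]; [exact: frechet|exact: scale].
Qed.

(** If the space is zero, then the group is trivial and acts trivially on the
real line: a unit vector may be assumed to exist. *)
Lemma exponent_unit_vector (a : R) : 0 < a -> equivariant_exponents hS a ->
  exists (V : completeNormedModType R) (dot : {dot V for idfun})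
         (A : H -> V -> V) (f : H -> V) (u : V),
    [/\ norm_of_dot dot, affine_isometric_action A,
        forall g x, f (g * x)%g = A g (f x), compression_bounds hS f a &
        `|u| = 1].
Proof.
move=> a0 [_ [V [dot [A [f [hV A_action fA f_bounds]]]]]].
have [[v v0]|noV] := pselect (exists v : V, v != 0).
  exists V, dot, A, f, (`|v|^-1 *: v); split=> //.
  by rewrite normrZ normfV normr_id mulVf // normr_eq0.
have H_trivial (x y : H) : x = y.
  have [C1 [C2 [C1_gt0 _ /(_ x y)[f_ge _]]]] := f_bounds.
  apply/eqP/negP => /negP xy; have := f_ge xy.
  have -> : f x - f y = 0.
    by apply: contrapT => /eqP nz; apply: noV; exists (f x - f y).
  rewrite normr0 leNgt => /negP; apply.
  rewrite mulr_gt0 // powR_gt0 // ltr0n lt0n.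
  apply: contraNneq xy => /word_length_eq0 xy1.
  by rewrite -(mulVKg x y) xy1 mulg1.
have [dot' hdot'] := euclidean_norm_of_dot real_line_euclidean.
exists (R^o : completeNormedModType R), dot', (fun _ v => v), (fun=> 0), 1.
split=> //; last by rewrite normr1.
  split=> // g; exists idfun, 0 => v; exact: esym (addr0 v).
exists 1, 1; split=> // x y.
by rewrite (H_trivial x y) eqxx subrr normr0 mul1r; split.
Qed.

(** With [b] the minimum of [a] and [1/2], the power [2 b] is subadditive, so
it may be taken term by term in the length of an element: the range of the
cursor is counted by half-spaces, and each lamp [h] contributes at most
[|h| ^ (2 a)], which the embedding of the lamp group controls. *)
Lemma wreath_exponent (a : R) : 0 < a -> equivariant_exponents hS a ->
  equivariant_exponents hT (Num.min a 2^-1).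
Proof.
move=> a0 Ea; have [V [dot [A [f [u [hV A_action fA f_bounds u1]]]]]] :=
  exponent_unit_vector a0 Ea.
case: f_bounds => C1 [C [C1_gt0 _ f_bounds]].
set b := Num.min a 2^-1.
have b0 : 0 < b by rewrite lt_min a0 invr_gt0 ltr0n.
have b2 : b <= 2^-1 by rewrite ge_min lexx orbT.
have ba : b <= a by rewrite ge_min lexx.
split; first by rewrite (ltW b0) (le_trans b2) // invf_le1 // ler1n.
have [dot' hdot'] := euclidean_norm_of_dot
  (l2_euclidean (site H) (norm_of_dot_euclidean hV)).
exists (l2 (site H) V : completeNormedModType R), dot'.
exists (embedding_action f u A_action), (embedding f u).
pose F := embedding f u.
have F_action := embedding_action_isometric u A_action fA.
have F_equivariant := embedding_equivariant u A_action fA.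
split=> //.
have [C2 C2_gt0 F_lip] := equivariant_lipschitz hT F_action F_equivariant.
have [D len_le] := wreath_length_le hS hT.
pose p : R := b * 2.
have p01 : 0 < p <= 1 by rewrite mulr_gt0 //= -ler_pdivlMr // mul1r.
have p0 : 0 < p by case/andP: p01.
(* [D.+1] compares the length with the range and the lamps, [C1 ^- 2] compares
   the length of a lamp with its image by [f]. *)
pose K : R := D.+1%:R `^ p * (1 + C1 ^- 2).
have K_gt0 : 0 < K.
  by rewrite mulr_gt0 ?powR_gt0 ?ltr0n // addr_gt0 // invr_gt0 exprn_gt0.
have f_ge h : (word_length hS h)%:R `^ p <= C1 ^- 2 * `|f h - f 1%g| ^+ 2.
  have [->|h1] := eqVneq h 1%g.
    by rewrite word_length1 powR0 ?gt_eqF // mulr_ge0 ?invr_ge0 ?sqr_ge0.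
  have h_gt0 : (0 < word_length hS h)%N.
    by rewrite lt0n; apply: contra_neq h1 => /word_length_eq0.
  rewrite mulrC ler_pdivlMr ?exprn_gt0 // mulrC.
  have [/(_ _)f_h _] := f_bounds 1%g h; rewrite eq_sym in f_h.
  have {f_h} := f_h h1; rewrite word_dist1 distrC => f_h.
  apply: (@le_trans _ _ ((C1 * (word_length hS h)%:R `^ a) ^+ 2)).
    rewrite exprMn ler_pM2l ?exprn_gt0 // -powR_mulrn ?powR_ge0 // -powRrM.
    by apply: ler_powR; rewrite ?ler1n // ler_pM2r.
  by rewrite ler_pXn2r ?nnegrE // mulr_ge0 ?powR_ge0 // ltW.
have F_ge g : (word_length hT g)%:R `^ p <= K * `|F g| ^+ 2.
  pose m := reach true g; pose n := reach false g.
  pose lampg (i : 'I_(m + n).+1) : H := lamp_at (lamp g) (i%:Z - m%:Z).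
  have len_g := len_le g m n (@reach_support _ g) (reach_cursor g).
  pose s : seq int := [seq i%:Z - m%:Z | i <- iota 0 (m + n).+1].
  have s_uniq : uniq s.
    by rewrite map_inj_uniq ?iota_uniq // => i j /addIr [].
  have := embedding_norm_ge f u1 g s_uniq.
  rewrite -/F -/m -/n => F_ge.
  have sum_s : \sum_(x <- s) `|f (lamp_at (lamp g) x) - f 1%g| ^+ 2 =
      \sum_i `|f (lampg i) - f 1%g| ^+ 2.
    by rewrite big_map -[iota _ _]/(index_iota 0 (m + n).+1) big_mkord.
  have {len_g} : ((word_length hT g)%:R : R) <= D.+1%:R *
      ((m + n)%:R + \sum_i (word_length hS (lampg i))%:R).
    rewrite -natr_sum -natrD -natrM ler_nat (leq_trans len_g) //.
    by rewrite leq_mul2r leqnSn orbT.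
  move=> /(ge0_ler_powR (ltW p0)) len_g.
  have {len_g} := len_g _ _.
  rewrite !nnegrE ler0n mulr_ge0 ?addr_ge0 ?sumr_ge0 //.
  move=> /(_ isT isT) /le_trans; apply.
  rewrite powRM ?addr_ge0 ?sumr_ge0 // /K -mulrA ler_pM2l ?powR_gt0 ?ltr0n //.
  apply: (le_trans (powR_subadd p01 _ _)); rewrite ?ler0n ?sumr_ge0 //.
  have range_le : (m + n)%:R `^ p <= (m + n)%:R :> R.
    have [->|mn0] := posnP (m + n)%N; first by rewrite powR0 ?gt_eqF.
    by apply: ler1_powR; rewrite ?ler1n //; case/andP: p01.
  have lamps_le : (\sum_i (word_length hS (lampg i))%:R) `^ p <=
      C1 ^- 2 * \sum_i `|f (lampg i) - f 1%g| ^+ 2.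
    apply: (le_trans (powR_sum_le p01 _ _)) => //.
    by rewrite mulr_sumr; apply: ler_sum => i _; exact: f_ge.
  apply: (le_trans (lerD range_le lamps_le)).
  have C'0 : 0 <= C1 ^- 2 by rewrite invr_ge0 exprn_ge0 // ltW.
  have sum0 : 0 <= \sum_i `|f (lampg i) - f 1%g| ^+ 2.
    by apply: sumr_ge0 => i _; exact: sqr_ge0.
  rewrite sum_s in F_ge; rewrite mulrDl mul1r lerD //.
    by apply: le_trans F_ge; rewrite lerDl.
  by rewrite ler_wpM2l //; apply: le_trans F_ge; rewrite lerDr ler0n.
exists (Num.sqrt K)^-1, C2; split=> // [|x y].
  by rewrite invr_gt0 sqrtr_gt0.
split=> [_|]; last exact: F_lip.
have -> : `|F x - F y| = `|F (x^-1 * y)%g|.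
  case: F_action => _ _ _ F_isom.
  have F1 : F 1%g = 0 by apply: l2P => i; rewrite /F embeddingE subrr.
  rewrite -[F (x^-1 * y)%g]subr0 -F1 -(F_isom x (F (x^-1 * y)%g)).
  by rewrite -!F_equivariant mulVKg mulg1 distrC.
rewrite mulrC ler_pdivrMr ?sqrtr_gt0 //.
rewrite -(@ler_pXn2r _ 2) ?nnegrE ?powR_ge0 ?mulr_ge0 ?sqrtr_ge0 //.
rewrite exprMn (sqr_sqrtr (ltW K_gt0)) [leRHS]mulrC -powR_mulrn ?powR_ge0 //.
by rewrite -powRrM; exact: F_ge.
Qed.

End LowerBound.

Section CompressionBounds.
Variables (R : realType) (G : groupType) (S : seq G) (hS : generates S).

Lemma equivariant_compression_ge (a : R) :
  equivariant_exponents hS a -> a <= equivariant_compression R hS.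
Proof. by move=> Ea; apply: ub_le_sup => //; exists 1 => b [/andP[]]. Qed.

Let no_exponent : ~ (exists a, @equivariant_exponents R _ _ hS a) ->
  equivariant_compression R hS = 0.
Proof.
move=> noE; rewrite /equivariant_compression.
rewrite (_ : equivariant_exponents hS = set0) ?sup0 //.
by apply/seteqP; split=> // a Ea; apply: noE; exists a.
Qed.

Lemma equivariant_compression_ge0 : 0 <= equivariant_compression R hS.
Proof.
have [[a Ea]|/no_exponent ->//] :=
  pselect (exists a, @equivariant_exponents R _ _ hS a).
by apply: le_trans (equivariant_compression_ge Ea); case: Ea => /andP[].
Qed.

Lemma equivariant_compression_le (c : R) : 0 <= c ->
    (forall a : R, equivariant_exponents hS a -> a <= c) ->
  equivariant_compression R hS <= c.
Proof.
move=> c0 Ec; have [[a Ea]|/no_exponent ->//] :=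
  pselect (exists a, @equivariant_exponents R _ _ hS a).
by apply: ge_sup => //; exists a.
Qed.

End CompressionBounds.

Theorem corollary0p3 (R : realType) (H : groupType)
    (S : seq H) (hS : generates S) (hH : amenable R H)
    (T : seq (wreathZ H)) (hT : generates T) :
  equivariant_compression R hS >= equivariant_compression R hT /\
  equivariant_compression R hT >=
    equivariant_compression R hS / (equivariant_compression R hS + 1).
Proof.
have rS0 := equivariant_compression_ge0 R hS.
have rT0 := equivariant_compression_ge0 R hT.
split.
  apply: equivariant_compression_le => // a /(equivariant_exponents_wreath hS).
  exact: equivariant_compression_ge.
have rS1 : equivariant_compression R hS <= 1.
  by apply: equivariant_compression_le => // a [/andP[]].
rewrite ler_pdivrMr ?ltr_wpDl //.
(* With r the compression of the lamp group, r / (r + 1) is at most r, and at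
   most 1/2 because r <= 1; and r or 1/2 bounds the other compression below. *)
have [half|small] := leP 2^-1 (equivariant_compression R hT).
  by nra.
suff : equivariant_compression R hS <= equivariant_compression R hT by nra.
apply: equivariant_compression_le => // a Ea.
have [a0|a0] := leP a 0; first exact: le_trans a0 rT0.
have := equivariant_compression_ge (wreath_exponent hT a0 Ea).
by rewrite ge_min [2^-1 <= _]leNgt small orbF.
Qed.
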